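(* Let $(X,\mathcal{B}(X),\mu)$ be a $\sigma$-finite measure space such that the corresponding Hilbert space $L^2(X)$ is endowed with an orthonormal basis $(\Phi_n)_{n\in\mathbb{N}}$. Then the projection operators $$P_nf:=\sum_{k=0}^n\langle f,\Phi_k\rangle\Phi_k,\qquad f\in L^2(X),\ n\in\mathbb{N},$$ satisfy, for every $N\in\mathbb{Z}_+$ and every $f\in L^2(X)$, the oscillation estimate $$\sup_{J\in\mathbb{Z}_+}\sup_{I\in\mathfrak{S}_J(\mathbb{N}_{\le N})}\bigl\|O^2_{I,J}(P_nf:n\in\mathbb{N}_{\le N})\bigr\|_{L^2(X)}\lesssim\log(N+1)\,\|f\|_{L^2(X)}.$$ Furthermore, if the projection operators $P_n$ satisfy the maximal estimate $$\Bigl\|\sup_{n\in\mathbb{N}}|P_nf|\Bigr\|_{L^2(X)}\lesssim\|f\|_{L^2(X)},\qquad f\in L^2(X),$$ then one has the uniform bound $$\sup_{J\in\mathbb{Z}_+}\sup_{I\in\mathfrak{S}_J(\mathbb{N})}\bigl\|O^2_{I,J}(P_nf:n\in\mathbb{N})\bigr\|_{L^2(X)}\lesssim\|f\|_{L^2(X)},\qquad f\in L^2(X).$$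
   Context: $\mathbb{N}=\{0,1,2,\ldots\}$, $\mathbb{Z}_+=\{1,2,\ldots\}$, $\mathbb{N}_{\le N}=\{0,1,\ldots,N\}$. $A\lesssim B$ means $A\le CB$ with a constant $C>0$ independent of $f$, $N$, $J$, $I$ (in the last estimate $C$ may depend on the constant in the assumed maximal estimate). For $\mathbb{I}\subseteq\mathbb{N}$, $\mathfrak{S}_J(\mathbb{I})$ is the set of strictly increasing sequences $I=(I_0<I_1<\cdots<I_J)$ of elements of $\mathbb{I}$; a supremum over the empty set is zero. For a family $(\mathfrak{a}_n:n\in\mathbb{I})$ of complex-valued measurable functions on $X$, $$O^2_{I,J}(\mathfrak{a}_n(x):n\in\mathbb{I}):=\Bigl(\sum_{j=0}^{J-1}\sup_{n\in\mathbb{I},\,I_j\le n<I_{j+1}}|\mathfrak{a}_n(x)-\mathfrak{a}_{I_j}(x)|^2\Bigr)^{1/2}.$$ *)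

(* Defs.v *)
From HB Require Import structures.
From mathcomp Require Import all_boot all_order all_algebra.
From mathcomp Require Import complex.
From mathcomp Require Import all_classical all_reals all_analysis.

Set Implicit Arguments.
Unset Strict Implicit.
Unset Printing Implicit Defensive.
Import Order.TTheory GRing.Theory Num.Theory.
Import numFieldNormedType.Exports.

Local Open Scope classical_set_scope.
Local Open Scope ring_scope.
Local Open Scope complex_scope.

Section L2.
Context d (T : measurableType d) (R : realType).
Implicit Types (mu : {measure set T -> \bar R}) (f g : T -> R[i]).

(* R[i] carries no measurable structure in the library; a complex-valued
   function is measurable when its real and imaginary parts are. *)
Definition cmeasurable f : Prop :=
  measurable_fun [set: T] (fun x => complex.Re (f x)) /\
  measurable_fun [set: T] (fun x => complex.Im (f x)).

Definition L2norm mu f : \bar R := Lnorm mu 2%:E (fun x => (Normc.normc (f x))%:E).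

(* Square-integrable functions, not quotiented by a.e. equality. *)
Definition L2 mu : set (T -> R[i]) :=
  [set f | cmeasurable f /\ (L2norm mu f < +oo)%E].

Definition cintegral mu f : R[i] :=
  (\int[mu]_x complex.Re (f x)) +i* (\int[mu]_x complex.Im (f x)).

Definition inner mu f g : R[i] := cintegral mu (fun x => f x * (g x)^*).

(* Orthonormal system in L2 whose finite linear combinations are dense. *)
Definition orthonormal_basis mu (Phi : nat -> T -> R[i]) : Prop :=
  [/\ forall n, L2 mu (Phi n),
      forall m n, inner mu (Phi m) (Phi n) = (m == n)%:R
    & forall f, L2 mu f -> forall e : R, 0 < e ->
      exists (n : nat) (c : nat -> R[i]),
        (L2norm mu (fun x => f x - \sum_(k < n) c k * Phi k x)%R < e%:E)%E].

Definition proj_op mu (Phi : nat -> T -> R[i]) (n : nat) f : T -> R[i] :=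
  fun x => \sum_(k < n.+1) inner mu f (Phi k) * Phi k x.

End L2.

Section Oscillation.
Context (R : realType).

(* Supremum of a nonnegative family, with the supremum over the empty set
   equal to 0 (ereal_sup of the empty set is -oo). *)
Definition nnsup (K : Type) (D : set K) (F : K -> \bar R) : \bar R :=
  ereal_sup (0%E |` [set F k | k in D]).

Definition incr_seqs (J : nat) (II : set nat) : set (J.+1.-tuple nat) :=
  [set I : J.+1.-tuple nat |
    sorted ltn I /\ forall j : 'I_J.+1, II (tnth I j)].

Definition osc2 (T : Type) (II : set nat) (J : nat) (I : J.+1.-tuple nat)
    (a : nat -> T -> R[i]) (x : T) : \bar R :=
  ((\sum_(j < J)
      nnsup [set n | II n /\ (nth 0%N I j <= n < nth 0%N I j.+1)%N]
        (fun n => (Normc.normc (a n x - a (nth 0%N I j) x) ^+ 2)%:E)) `^ 2^-1)%E.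

End Oscillation.

Arguments incr_seqs : clear implicits.

(* Main.v *)
Require Import Defs.
From mathcomp Require Import all_boot all_order all_algebra.
From mathcomp Require Import complex.
From mathcomp Require Import all_classical all_reals all_analysis.
From mathcomp Require Import measurable_realfun.
From mathcomp Require Import ring lra.
Import Order.TTheory GRing.Theory Num.Theory.
Local Open Scope classical_set_scope.
Local Open Scope ring_scope.
Set Implicit Arguments.
Unset Strict Implicit.
Unset Printing Implicit Defensive.

(** Both estimates come from one transference principle. Between two
    consecutive indices [I_j <= n < I_(j+1)] the difference [P_n f - P_(I_j) f]
    is a partial sum of the block of the expansion of [f] whose frequencies lie
    strictly between [I_j] and [I_(j+1)]. If partial sums of such blocks obey an
    L2 maximal inequality with constant [K], then the [j]th supremum in the
    squared oscillation integrates to at most [K ^+ 2] times the energy of the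
    block; the blocks are disjoint, so Bessel's inequality bounds the total by
    [K ^+ 2] times the squared norm of [f]. This is [oscillation_le_maximal].

    For frequencies at most [N] the maximal inequality is that of Rademacher and
    Menshov ([rademacher_menshov]), with [K] of the order of [log (N + 1)]. It
    compares an initial segment of a block of length [2 ^ m] with the energies
    of all dyadic subblocks: pointwise the squared modulus is at most [m + 1]
    times the total dyadic energy, and by orthogonality each of the [m + 1]
    dyadic scales carries the energy of the whole block, which gives
    [K = m + 1].

    For the uniform bound, [K] is the constant of the assumed maximal estimate:
    the partial sums of a block are exactly the projections [P_n] of the block,
    itself an element of L2, so the estimate applies to it directly.

    Everything rests on orthonormality: the Parseval identity for finite sums
    and Bessel's inequality. *)

(** * Complex moduli and suprema *)

Section ComplexModulus.
Context (R : realType).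
Implicit Types z w : R[i].

Lemma normc_sqr z :
  Normc.normc z ^+ 2 = complex.Re z ^+ 2 + complex.Im z ^+ 2.
Proof. by case: z => a b /=; rewrite sqr_sqrtr ?addr_ge0 ?sqr_ge0. Qed.

Lemma normc_ge0 z : 0 <= Normc.normc z.
Proof. by case: z => a b; exact: sqrtr_ge0. Qed.

Lemma mul_conjc_sqr z : z * z^*%C = (Normc.normc z ^+ 2)%:C%C.
Proof.
rewrite normc_sqr; case: z => a b; apply/eqP; rewrite eq_complex /=.
by apply/andP; split; apply/eqP; ring.
Qed.

(** Since [2 |z| |w| <= M |z|^2 + |w|^2 / M], the constant grows from [M] to
    only [M + 1]; the plain factor 2 would compound to a power of [N], rather
    than of its logarithm, when blocks are doubled repeatedly. *)
Lemma normcD_sqr_le z w (M p q : R) : 0 < M -> Normc.normc z ^+ 2 <= p ->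
  Normc.normc w ^+ 2 <= M * q -> Normc.normc (z + w) ^+ 2 <= (M + 1) * (p + q).
Proof.
move=> M0 zp wq.
have zw : Normc.normc (z + w) <= Normc.normc z + Normc.normc w.
  exact: le_normcD.
have h1 : Normc.normc (z + w) ^+ 2 <= (Normc.normc z + Normc.normc w) ^+ 2.
  by rewrite ler_sqr ?nnegrE ?addr_ge0 ?normc_ge0.
apply: (le_trans h1); rewrite -(ler_pM2l M0).
have := sqr_ge0 (M * Normc.normc z - Normc.normc w).
have : M * (M + 1) * Normc.normc z ^+ 2 <= M * (M + 1) * p.
  by rewrite ler_wpM2l// mulr_ge0 ?addr_ge0// ltW.
have : (M + 1) * Normc.normc w ^+ 2 <= (M + 1) * (M * q).
  by rewrite ler_wpM2l// addr_ge0// ltW.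
nra.
Qed.

End ComplexModulus.

Section Nnsup.
Context (R : realType) (K : Type).
Implicit Types (D : set K) (F : K -> \bar R).
Local Open Scope ereal_scope.

Lemma nnsup_ge0 D F : 0 <= nnsup D F.
Proof. by apply: ereal_sup_ubound; left. Qed.

Lemma nnsup_ub D F k : D k -> F k <= nnsup D F.
Proof. by move=> Dk; apply: ereal_sup_ubound; right; exists k. Qed.

Lemma nnsup_le D F M : 0 <= M -> (forall k, D k -> F k <= M) -> nnsup D F <= M.
Proof.
by move=> M0 FM; apply: ge_ereal_sup => _ [->//|[k Dk <-]]; exact: FM.
Qed.

End Nnsup.

(** Membership in [D] does not depend on the point, so the supremum over [D] is
    that of a full sequence in which the excluded terms are replaced by 0; it is
    then a countable supremum of measurable functions. *)
Lemma measurable_nnsup d (T : measurableType d) (R : realType) (D : set nat)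
    (F : nat -> T -> \bar R) :
  (forall n, measurable_fun [set: T] (F n)) ->
  measurable_fun [set: T] (fun x => nnsup D (F ^~ x)).
Proof.
move=> mF.
pose G n x : \bar R := if `[< D n >] then maxe (F n x) 0%E else 0%E.
have -> : (fun x => nnsup D (F ^~ x)) = (fun x => esups (G ^~ x) 0%N).
  apply/funext => x; apply/eqP; rewrite eq_le; apply/andP; split.
    have ubG n : (G n x <= esups (G ^~ x) 0%N)%E.
      by apply: ereal_sup_ubound; exists n.
    apply: nnsup_le => [|n Dn].
      apply: le_trans (ubG 0%N); rewrite /G; case: ifP => // _.
      by rewrite le_max lexx orbT.
    apply: le_trans (ubG n); rewrite /G; case: asboolP => // _.
    by rewrite le_max lexx.
  apply: ge_ereal_sup => _ [n _ <-]; rewrite /G; case: asboolP => [Dn|_].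
    rewrite ge_max; apply/andP; split; last exact: nnsup_ge0.
    exact: (nnsup_ub (F ^~ x)).
  exact: nnsup_ge0.
apply: measurable_fun_esups => n; rewrite /G.
case: `[< D n >]; last exact: measurable_cst.
exact: measurable_maxe.
Qed.

(** * Square-integrable functions and the inner product *)

Section InnerProduct.
Context d (T : measurableType d) (R : realType).
Variable mu : {measure set T -> \bar R}.
Implicit Types (f g h : T -> R[i]).

Definition cintegrable f : Prop :=
  mu.-integrable [set: T] (EFin \o (fun x => complex.Re (f x))) /\
  mu.-integrable [set: T] (EFin \o (fun x => complex.Im (f x))).

Lemma cintegralD f g : cintegrable f -> cintegrable g ->
  cintegral mu (fun x => f x + g x) = cintegral mu f + cintegral mu g.
Proof.
move=> [rf jf] [rg jg]; rewrite /cintegral.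
rewrite (_ : (fun x => complex.Re (f x + g x)) =
  (fun x => complex.Re (f x) + complex.Re (g x))); last first.
  by apply/funext => x; case: (f x) => ? ?; case: (g x).
rewrite (_ : (fun x => complex.Im (f x + g x)) =
  (fun x => complex.Im (f x) + complex.Im (g x))); last first.
  by apply/funext => x; case: (f x) => ? ?; case: (g x).
by rewrite !RintegralD.
Qed.

Lemma cintegralZ (c : R[i]) f : cintegrable f ->
  cintegral mu (fun x => c * f x) = c * cintegral mu f.
Proof.
move=> [rf jf]; rewrite /cintegral; case: c => a b.
rewrite (_ : (fun x => complex.Re ((a +i* b)%C * f x)) =
  (fun x => a * complex.Re (f x) - b * complex.Im (f x))); last first.
  by apply/funext => x; case: (f x).
rewrite (_ : (fun x => complex.Im ((a +i* b)%C * f x)) =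
  (fun x => a * complex.Im (f x) + b * complex.Re (f x))); last first.
  by apply/funext => x; case: (f x).
have iZ (r : R) (u : T -> R) : mu.-integrable [set: T] (EFin \o u) ->
    mu.-integrable [set: T] (EFin \o (fun x => r * u x)).
  exact: integrableZl.
rewrite RintegralB ?RintegralD ?RintegralZl//; exact: iZ.
Qed.

Lemma cintegral_conj f : cintegrable f ->
  cintegral mu (fun x => (f x)^*%C) = ((cintegral mu f)^*)%C.
Proof.
move=> [rf jf]; rewrite /cintegral.
rewrite (_ : (fun x => complex.Re ((f x)^*)%C) =
  (fun x => complex.Re (f x))); last first.
  by apply/funext => x; case: (f x).
rewrite (_ : (fun x => complex.Im ((f x)^*)%C) =
  (fun x => (-1) * complex.Im (f x))); last first.
  by apply/funext => x; case: (f x) => ? ? /=; rewrite mulN1r.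
by rewrite RintegralZl// mulN1r.
Qed.

Lemma measurable_normc_sqr f : cmeasurable f ->
  measurable_fun [set: T] (fun x => (Normc.normc (f x) ^+ 2)%:E).
Proof.
move=> [mr mi]; apply/measurable_EFinP.
under eq_fun do rewrite normc_sqr.
by apply: measurable_funD; exact: measurable_funX.
Qed.

Lemma measurable_normc f : cmeasurable f ->
  measurable_fun [set: T] (fun x => (Normc.normc (f x))%:E).
Proof.
move=> mf.
rewrite (_ : (fun x => _) = (fun x => (Normc.normc (f x) ^+ 2)%:E `^ 2^-1))%E.
  exact: measurableT_comp (measurable_poweR _) (measurable_normc_sqr mf).
apply/funext => x.
by rewrite poweR_EFin powR12_sqrt ?sqr_ge0// sqrtr_sqr ger0_norm ?normc_ge0.
Qed.

Lemma cmeasurableD f g : cmeasurable f -> cmeasurable g ->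
  cmeasurable (fun x => f x + g x).
Proof.
move=> [rf jf] [rg jg]; split.
  rewrite (_ : (fun x => _) = (fun x => complex.Re (f x) + complex.Re (g x))).
    exact: measurable_funD.
  by apply/funext => x; case: (f x) => ? ?; case: (g x).
rewrite (_ : (fun x => _) = (fun x => complex.Im (f x) + complex.Im (g x))).
  exact: measurable_funD.
by apply/funext => x; case: (f x) => ? ?; case: (g x).
Qed.

Lemma cmeasurableM f g : cmeasurable f -> cmeasurable g ->
  cmeasurable (fun x => f x * g x).
Proof.
move=> [rf jf] [rg jg]; split.
  rewrite (_ : (fun x => _) = (fun x => complex.Re (f x) * complex.Re (g x)
    - complex.Im (f x) * complex.Im (g x))).
    by apply: measurable_funB; exact: measurable_funM.
  by apply/funext => x; case: (f x) => ? ?; case: (g x).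
rewrite (_ : (fun x => _) = (fun x => complex.Re (f x) * complex.Im (g x)
    + complex.Im (f x) * complex.Re (g x))).
  by apply: measurable_funD; exact: measurable_funM.
by apply/funext => x; case: (f x) => ? ?; case: (g x).
Qed.

Lemma cmeasurable_cst (c : R[i]) : cmeasurable (fun _ : T => c).
Proof. by split; exact: measurable_cst. Qed.

Lemma cmeasurable_conj f : cmeasurable f -> cmeasurable (fun x => (f x)^*%C).
Proof.
move=> [rf jf]; split.
  rewrite (_ : (fun x => _) = (fun x => complex.Re (f x)))//.
  by apply/funext => x; case: (f x).
rewrite (_ : (fun x => _) = (fun x => - complex.Im (f x))).
  exact: measurableT_comp.
by apply/funext => x; case: (f x).
Qed.

Lemma poweR2_EFin (r : R) : (`|r%:E| `^ 2 = (r ^+ 2)%:E)%E.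
Proof. by rewrite abse_EFin poweR_EFin powR_mulrn// real_normK ?num_real. Qed.

Lemma L2normE f :
  L2norm mu f = ((\int[mu]_x (Normc.normc (f x) ^+ 2)%:E) `^ 2^-1)%E.
Proof.
by rewrite /L2norm unlock; under eq_integral do rewrite poweR2_EFin.
Qed.

Lemma L2P f : L2 mu f <-> cmeasurable f /\
  mu.-integrable [set: T] (fun x => (Normc.normc (f x) ^+ 2)%:E).
Proof.
have E : (\int[mu]_x `|(Normc.normc (f x) ^+ 2)%:E| =
          \int[mu]_x (Normc.normc (f x) ^+ 2)%:E)%E.
  by apply: eq_integral => x _; rewrite gee0_abs// lee_fin sqr_ge0.
split=> -[mf].
  rewrite L2normE => fin; split => //; apply/integrableP.
  split; first exact: measurable_normc_sqr.
  rewrite E ltey; apply/eqP => oo; move: fin.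
  by rewrite oo poweRyr ?ltxx// invr_eq0 pnatr_eq0.
move=> /integrableP[_]; rewrite E => fin; split => //.
by rewrite L2normE poweR_lty.
Qed.

Lemma L2_cmeasurable f : L2 mu f -> cmeasurable f.
Proof. by case. Qed.

(** The real and imaginary parts of a product are dominated by the sum of the
    squared moduli of the factors. *)
Lemma cintegrable_mul_conj f g : L2 mu f -> L2 mu g ->
  cintegrable (fun x => f x * (g x)^*%C).
Proof.
move=> /L2P[mf intf] /L2P[mg intg].
have [mr mi] := cmeasurableM mf (cmeasurable_conj mg).
have intfg := integrableD measurableT intf intg.
split; apply: (le_integrable measurableT _ _ intfg) => //=.
- exact/measurable_EFinP.
- move=> x _; rewrite lee_fin [leRHS]ger0_norm ?addr_ge0 ?sqr_ge0//.
  rewrite !normc_sqr; case: (f x) => a b; case: (g x) => u v /=.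
  rewrite ler_norml; apply/andP; split.
    have := sqr_ge0 (a + u); have := sqr_ge0 (b + v).
    have := sqr_ge0 a; have := sqr_ge0 b; have := sqr_ge0 u; have := sqr_ge0 v.
    nra.
  have := sqr_ge0 (a - u); have := sqr_ge0 (b - v).
  have := sqr_ge0 a; have := sqr_ge0 b; have := sqr_ge0 u; have := sqr_ge0 v.
  nra.
- exact/measurable_EFinP.
- move=> x _; rewrite lee_fin [leRHS]ger0_norm ?addr_ge0 ?sqr_ge0//.
  rewrite !normc_sqr; case: (f x) => a b; case: (g x) => u v /=.
  rewrite ler_norml; apply/andP; split.
    have := sqr_ge0 (b + u); have := sqr_ge0 (a - v).
    have := sqr_ge0 a; have := sqr_ge0 b; have := sqr_ge0 u; have := sqr_ge0 v.
    nra.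
  have := sqr_ge0 (b - u); have := sqr_ge0 (a + v).
  have := sqr_ge0 a; have := sqr_ge0 b; have := sqr_ge0 u; have := sqr_ge0 v.
  nra.
Qed.

Lemma L2D f g : L2 mu f -> L2 mu g -> L2 mu (fun x => f x + g x).
Proof.
move=> /L2P[mf intf] /L2P[mg intg]; apply/L2P; split.
  exact: cmeasurableD.
have intfg := integrableZl measurableT 2%R (integrableD measurableT intf intg).
apply: (le_integrable measurableT _ _ intfg).
  exact/measurable_normc_sqr/cmeasurableD.
move=> x _; rewrite -EFinD -EFinM !abse_EFin lee_fin.
rewrite !ger0_norm ?sqr_ge0 ?mulr_ge0 ?addr_ge0 ?sqr_ge0//.
have -> : 2 * (Normc.normc (f x) ^+ 2 + Normc.normc (g x) ^+ 2) =
  (1 + 1) * (Normc.normc (f x) ^+ 2 + Normc.normc (g x) ^+ 2) by [].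
by apply: normcD_sqr_le => //; rewrite mul1r.
Qed.

Lemma L2Z (c : R[i]) f : L2 mu f -> L2 mu (fun x => c * f x).
Proof.
move=> /L2P[mf intf]; apply/L2P; split.
  exact: cmeasurableM (cmeasurable_cst c) mf.
apply: eq_integrable (integrableZl measurableT (Normc.normc c ^+ 2) intf) => //.
by move=> x _; rewrite Normc.normcM exprMn EFinM.
Qed.

Lemma L2_0 : L2 mu (fun _ => 0).
Proof.
apply/L2P; split; first exact: cmeasurable_cst.
apply: eq_integrable (integrable0 mu [set: T]) => // x _.
by rewrite Normc.normc0 expr0n.
Qed.

Lemma innerDl f g h : L2 mu f -> L2 mu g -> L2 mu h ->
  inner mu (fun x => f x + g x) h = inner mu f h + inner mu g h.
Proof.
move=> Lf Lg Lh; rewrite /inner -cintegralD//; try exact: cintegrable_mul_conj.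
by congr cintegral; apply/funext => x; rewrite mulrDl.
Qed.

Lemma innerZl (c : R[i]) f h : L2 mu f -> L2 mu h ->
  inner mu (fun x => c * f x) h = c * inner mu f h.
Proof.
move=> Lf Lh; rewrite /inner -cintegralZ; last exact: cintegrable_mul_conj.
by congr cintegral; apply/funext => x; rewrite mulrA.
Qed.

Lemma inner_conj f g : L2 mu f -> L2 mu g ->
  inner mu g f = ((inner mu f g)^*)%C.
Proof.
move=> Lf Lg; rewrite /inner -cintegral_conj; last exact: cintegrable_mul_conj.
by congr cintegral; apply/funext => x; rewrite rmorphM /= conjcK mulrC.
Qed.

Lemma integral_normc_sqr f : L2 mu f ->
  (\int[mu]_x (Normc.normc (f x) ^+ 2)%:E)%E = (complex.Re (inner mu f f))%:E.
Proof.
move=> /L2P[mf intf]; rewrite /inner /cintegral /=.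
rewrite (_ : (fun x => complex.Re _) = (fun x => Normc.normc (f x) ^+ 2)).
  by rewrite fineK//; exact: integrable_fin_num.
by apply/funext => x; rewrite mul_conjc_sqr.
Qed.

Lemma inner_self_ge0 f : L2 mu f -> 0 <= complex.Re (inner mu f f).
Proof.
move=> Lf; rewrite -lee_fin -integral_normc_sqr//.
by apply: integral_ge0 => x _; rewrite lee_fin sqr_ge0.
Qed.

(** * Orthonormal expansions *)

Section Orthonormal.
Variable Phi : nat -> T -> R[i].
Hypothesis L2Phi : forall n, L2 mu (Phi n).
Hypothesis ortho : forall m n, inner mu (Phi m) (Phi n) = (m == n)%:R.
Implicit Types (b : nat -> R[i]).

Definition lincomb b (s t : nat) (x : T) : R[i] :=
  \sum_(s <= k < t) b k * Phi k x.

Lemma L2_sum (r : seq nat) b : L2 mu (fun x => \sum_(k <- r) b k * Phi k x).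
Proof.
elim: r => [|k r IH].
  by under eq_fun do rewrite big_nil; exact: L2_0.
by under eq_fun do rewrite big_cons; apply: L2D IH; exact: L2Z.
Qed.

Lemma L2_lincomb b s t : L2 mu (lincomb b s t).
Proof. exact: L2_sum. Qed.

Lemma inner_lincombl b s t g : L2 mu g ->
  inner mu (lincomb b s t) g = \sum_(s <= k < t) b k * inner mu (Phi k) g.
Proof.
move=> Lg; rewrite /lincomb; elim: (index_iota s t) => [|k r IH].
  rewrite big_nil (_ : (fun x => _) = (fun x => 0 * (fun=> 0) x)).
    by rewrite innerZl ?mul0r//; exact: L2_0.
  by apply/funext => x; rewrite big_nil mul0r.
rewrite big_cons -IH -innerZl// -innerDl//; last 2 first.
- exact: L2Z.
- exact: L2_sum.
by congr inner; apply/funext => x; rewrite big_cons.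
Qed.

Lemma inner_lincomb_Phi b s t n :
  inner mu (lincomb b s t) (Phi n) = if (s <= n < t)%N then b n else 0.
Proof.
rewrite inner_lincombl//; case: ifPn => st.
  rewrite (bigD1_seq n) ?mem_index_iota ?iota_uniq//= ortho eqxx mulr1.
  by rewrite big1 ?addr0// => k kn; rewrite ortho (negbTE kn) mulr0.
rewrite big_seq big1// => k; rewrite mem_index_iota => kst.
by rewrite ortho; case: eqP kst st => [->->//|]; rewrite mulr0.
Qed.

Lemma inner_lincomb_self b s t :
  inner mu (lincomb b s t) (lincomb b s t) =
  (\sum_(s <= k < t) Normc.normc (b k) ^+ 2)%:C%C.
Proof.
rewrite inner_lincombl; last exact: L2_lincomb.
rewrite rmorph_sum /=; apply: eq_big_nat => k kst.
rewrite (inner_conj (L2_lincomb b s t) (L2Phi k)) inner_lincomb_Phi kst.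
exact: mul_conjc_sqr.
Qed.

Lemma parseval b s t :
  (\int[mu]_x (Normc.normc (lincomb b s t x) ^+ 2)%:E)%E =
  (\sum_(s <= k < t) Normc.normc (b k) ^+ 2)%:E.
Proof.
by rewrite integral_normc_sqr ?inner_lincomb_self//; exact: L2_lincomb.
Qed.

(** Expanding the squared norm of [f - g], where [g] is the projection of [f] on
    finitely many [Phi k], leaves the squared norm of [f] minus that of [g]. *)
Lemma bessel f s t : L2 mu f ->
  \sum_(s <= k < t) Normc.normc (inner mu f (Phi k)) ^+ 2
  <= complex.Re (inner mu f f).
Proof.
move=> Lf; set c := fun k => inner mu f (Phi k).
set g := lincomb c s t; have Lg : L2 mu g by exact: L2_lincomb.
have LNg : L2 mu (fun x => -1 * g x) by exact: L2Z.
have Lh : L2 mu (fun x => f x + -1 * g x) by exact: L2D.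
have gg : inner mu g g = (\sum_(s <= k < t) Normc.normc (c k) ^+ 2)%:C%C.
  exact: inner_lincomb_self.
have gf : inner mu g f = (\sum_(s <= k < t) Normc.normc (c k) ^+ 2)%:C%C.
  rewrite inner_lincombl// rmorph_sum /=; apply: eq_big_nat => k _.
  by rewrite (inner_conj Lf (L2Phi k)) mul_conjc_sqr.
have := inner_self_ge0 Lh.
rewrite innerDl// innerZl// (inner_conj Lh Lf) (inner_conj Lh Lg).
rewrite !innerDl// !innerZl// gg gf (inner_conj Lg Lf) gf.
set S := \sum_(_ <= _ < _) _; rewrite -/S.
case: (inner mu f f) => u v /=; lra.
Qed.

End Orthonormal.
End InnerProduct.

(** * From maximal inequalities to oscillation inequalities *)

Section Oscillation.
Context d (T : measurableType d) (R : realType).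
Variable mu : {measure set T -> \bar R}.
Variable Phi : nat -> T -> R[i].
Hypothesis L2Phi : forall n, L2 mu (Phi n).
Hypothesis ortho : forall m n, inner mu (Phi m) (Phi n) = (m == n)%:R.
Implicit Types (b : nat -> R[i]) (f : T -> R[i]).
Local Notation S := (lincomb Phi).

Lemma proj_op_sub f i n : (i <= n)%N -> forall x,
  proj_op mu Phi n f x - proj_op mu Phi i f x =
  S (fun k => inner mu f (Phi k)) i.+1 n.+1 x.
Proof.
move=> le_in x; rewrite /proj_op /lincomb.
rewrite -!(big_mkord xpredT (fun k => inner mu f (Phi k) * Phi k x)).
by rewrite (@big_cat_nat _ _ _ i.+1 0 n.+1)//= addrAC subrr add0r.
Qed.

Lemma lincomb_widenl b s t x :
  S b s t x = \sum_(0 <= k < t) (if (s <= k)%N then b k else 0) * Phi k x.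
Proof.
rewrite /lincomb (@big_nat_widenl _ _ _ s 0)// big_mkcond /=.
by apply: eq_bigr => k _; case: ifP; rewrite ?mul0r.
Qed.

Lemma sumr_consecutive_blocks (c : nat -> R) (J : nat) (I : seq nat) :
  (forall k, 0 <= c k) ->
  (forall j, (j < J)%N -> (nth 0 I j < nth 0 I j.+1)%N) ->
  \sum_(0 <= j < J) \sum_((nth 0 I j).+1 <= k < nth 0 I j.+1) c k <=
  \sum_(0 <= k < nth 0 I J) c k.
Proof.
move=> c0; elim: J => [|J IH] incI; first by rewrite big_geq// sumr_ge0.
rewrite big_nat_recr//=.
rewrite (@big_cat_nat _ _ _ (nth 0%N I J) 0 (nth 0%N I J.+1))//=; last first.
  exact/ltnW/incI.
apply: lerD; first by apply: IH => j jJ; apply: incI; rewrite ltnS ltnW.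
by rewrite [leRHS]big_ltn ?incI// lerDr.
Qed.

(** The block starts at [I_j + 1] because the projection at the index [I_j]
    itself is subtracted. Restricting the right end [t] to [II] is what allows a maximal
    constant depending on [N] when [II] consists of the integers up to [N]. *)
Lemma oscillation_le_maximal (II : set nat) (K : R) : 0 <= K ->
  (forall b s t, II t ->
    (\int[mu]_x nnsup [set n | II n /\ (n < t)%N]
       (fun n => (Normc.normc (S b s n.+1 x) ^+ 2)%:E)
     <= (K ^+ 2 * \sum_(s <= k < t) Normc.normc (b k) ^+ 2)%:E)%E) ->
  forall f J (I : J.+1.-tuple nat), L2 mu f -> incr_seqs J II I ->
  (Lnorm mu 2%:E (osc2 II I (fun n => proj_op mu Phi n f))
   <= K%:E * L2norm mu f)%E.
Proof.
move=> K0 maxK f J I Lf [sI II_I].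
set c := fun k => inner mu f (Phi k).
have nthII j : (j <= J)%N -> II (nth 0%N I j).
  move=> jJ; have := II_I (Ordinal (jJ : (j < J.+1)%N)).
  by rewrite (tnth_nth 0%N).
have incI j : (j < J)%N -> (nth 0 I j < nth 0 I j.+1)%N.
  move=> jJ; move/(sortedP 0%N): sI; apply; by rewrite size_tuple.
pose M j x := nnsup [set n | II n /\ (n < nth 0 I j.+1)%N]
  (fun n => (Normc.normc (S c (nth 0%N I j).+1 n.+1 x) ^+ 2)%:E).
have mS b s t : measurable_fun [set: T]
    (fun x => (Normc.normc (S b s t x) ^+ 2)%:E).
  exact/measurable_normc_sqr/L2_cmeasurable/(L2_lincomb L2Phi).
have mM j : measurable_fun [set: T] (M j) by exact: measurable_nnsup.
have oscE x : (`|osc2 II I (fun n => proj_op mu Phi n f) x| `^ 2 =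
    \sum_(j < J) nnsup [set n | II n /\ (nth 0%N I j <= n < nth 0%N I j.+1)%N]
      (fun n => (Normc.normc (S c (nth 0%N I j).+1 n.+1 x) ^+ 2)%:E))%E.
  rewrite /osc2 gee0_abs ?poweR_ge0// -poweRrM mulVf// poweRe1; last first.
    by apply: sume_ge0 => j _; exact: nnsup_ge0.
  apply: eq_bigr => j _; rewrite /nnsup; congr (ereal_sup (_ `|` _)).
  by apply: eq_imagel => n [_ /andP[jn _]]; rewrite proj_op_sub.
rewrite unlock L2normE.
have -> : (K%:E = (K ^+ 2)%:E `^ 2^-1)%E.
  by rewrite poweR_EFin powR12_sqrt ?sqr_ge0// sqrtr_sqr ger0_norm.
rewrite -poweRM ?lee_fin ?sqr_ge0//; last first.
  by apply: integral_ge0 => x _; rewrite lee_fin sqr_ge0.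
apply: gt0_ler_poweR => //.
- by rewrite in_itv /= leey andbT integral_ge0// => x _; rewrite poweR_ge0.
- rewrite in_itv /= leey andbT mule_ge0// ?lee_fin ?sqr_ge0// integral_ge0//.
  by move=> x _; rewrite lee_fin sqr_ge0.
under eq_integral do rewrite oscE.
apply: (@le_trans _ _ (\int[mu]_x \sum_(j < J) M j x)%E).
  apply: ge0_le_integral => //.
  - by move=> x _; apply: sume_ge0 => j _; exact: nnsup_ge0.
  - apply: emeasurable_sum => j; exact: measurable_nnsup.
  - by apply: emeasurable_sum => j.
  - move=> x _; apply: lee_sum => j _; apply: nnsup_le => [|n [IIn /andP[_ nj]]].
      exact: nnsup_ge0.
    exact: (nnsup_ub (fun n =>
      (Normc.normc (S c (nth 0%N I j).+1 n.+1 x) ^+ 2)%:E)).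
rewrite ge0_integral_sum//; last by move=> j x _; exact: nnsup_ge0.
rewrite integral_normc_sqr// -EFinM.
apply: (@le_trans _ _ (\sum_(j < J) (K ^+ 2 *
   \sum_((nth 0 I j).+1 <= k < nth 0 I j.+1) Normc.normc (c k) ^+ 2)%:E)%E).
  by apply: lee_sum => j _; apply: maxK; apply: nthII.
rewrite sumEFin lee_fin -mulr_sumr ler_wpM2l ?sqr_ge0//.
apply: le_trans (bessel L2Phi ortho 0 (nth 0%N I J) Lf).
rewrite -(big_mkord xpredT (fun j =>
   \sum_((nth 0 I j).+1 <= k < nth 0 I j.+1) Normc.normc (c k) ^+ 2)).
by apply: sumr_consecutive_blocks => // k; exact: sqr_ge0.
Qed.

(** * The Rademacher-Menshov inequality *)

(** The square function of the dyadic argument: one term for each node of the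
    binary tree obtained by halving [s, s + 2 ^ m) down to single indices. *)
Fixpoint dyadic_energy (a : nat -> R[i]) (m s : nat) : R :=
  Normc.normc (\sum_(s <= k < s + 2 ^ m) a k) ^+ 2 +
  (if m is m'.+1 then dyadic_energy a m' s + dyadic_energy a m' (s + 2 ^ m')
   else 0).

Lemma dyadic_energy_ge_block a m s :
  Normc.normc (\sum_(s <= k < s + 2 ^ m) a k) ^+ 2 <= dyadic_energy a m s.
Proof.
have pos m' s' : 0 <= dyadic_energy a m' s'.
  by elim: m' s' => [|m' IH] s' /=; rewrite !addr_ge0 ?sqr_ge0.
by case: m => [|m] /=; rewrite lerDl// addr_ge0.
Qed.

Lemma dyadic_energy_ge0 a m s : 0 <= dyadic_energy a m s.
Proof. by apply: le_trans (dyadic_energy_ge_block a m s); exact: sqr_ge0. Qed.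

(** Cutting the block at its midpoint, either the segment lies in the left half,
    or it is the whole left half, a single dyadic block, followed by an initial
    segment of the right half. So each doubling adds only one dyadic block, and
    the constant grows by one. *)
Lemma initial_segment_le_dyadic_energy a m s l : (l <= 2 ^ m)%N ->
  Normc.normc (\sum_(s <= k < s + l) a k) ^+ 2 <= m.+1%:R * dyadic_energy a m s.
Proof.
elim: m s l => [|m IH] s l lm.
  move: lm; rewrite expn0; case: l => [|[|//]] _.
    rewrite addn0 big_geq// Normc.normc0 expr0n.
    by apply: mulr_ge0 => //; exact: dyadic_energy_ge0.
  by rewrite mul1r; exact: (dyadic_energy_ge_block a 0 s).
have step : m.+2%:R * (dyadic_energy a m s + dyadic_energy a m (s + 2 ^ m)) <=
    m.+2%:R * dyadic_energy a m.+1 s.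
  by rewrite ler_wpM2l// /= lerDr sqr_ge0.
apply: le_trans step; have [lm'|lm'] := leqP l (2 ^ m).
  apply: (le_trans (IH _ _ lm')).
  apply: ler_pM => //; [exact: dyadic_energy_ge0|by rewrite ler_nat|].
  by rewrite lerDl dyadic_energy_ge0.
have el : (l = 2 ^ m + (l - 2 ^ m))%N by rewrite subnKC// ltnW.
rewrite (@big_cat_nat _ _ _ (s + 2 ^ m) s (s + l))//= ?leq_addr ?leq_add2l 1?ltnW//.
rewrite -[m.+2%:R]natr1; apply: normcD_sqr_le => //.
  exact: dyadic_energy_ge_block.
rewrite {1}el addnA; apply: IH.
by rewrite leq_subLR addnn -mul2n -expnS.
Qed.

(** By orthogonality the dyadic blocks of one length have together the energy of
    the whole block; there are [m.+1] lengths. Measurability is proved in the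
    same induction because the additivity of the integral requires it. *)
Lemma integral_dyadic_energy b m s :
  measurable_fun [set: T]
    (fun x => (dyadic_energy (fun k => b k * Phi k x) m s)%:E) /\
  (\int[mu]_x (dyadic_energy (fun k => b k * Phi k x) m s)%:E)%E =
  (m.+1%:R * \sum_(s <= k < s + 2 ^ m) Normc.normc (b k) ^+ 2)%:E.
Proof.
have mS s' t : measurable_fun [set: T]
    (fun x => (Normc.normc (S b s' t x) ^+ 2)%:E).
  exact/measurable_normc_sqr/L2_cmeasurable/(L2_lincomb L2Phi).
elim: m s => [|m IH] s.
  have E : (fun x => (dyadic_energy (fun k => b k * Phi k x) 0 s)%:E) =
    (fun x => (Normc.normc (S b s (s + 2 ^ 0) x) ^+ 2)%:E).
    by apply/funext => x /=; rewrite addr0.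
  rewrite E; split; first exact: mS.
  by rewrite (parseval L2Phi ortho) mul1r.
have [m1 e1] := IH s; have [m2 e2] := IH (s + 2 ^ m)%N.
have E : (fun x => (dyadic_energy (fun k => b k * Phi k x) m.+1 s)%:E) =
    (fun x => (Normc.normc (S b s (s + 2 ^ m.+1) x) ^+ 2)%:E +
    ((dyadic_energy (fun k => b k * Phi k x) m s)%:E +
     (dyadic_energy (fun k => b k * Phi k x) m (s + 2 ^ m))%:E))%E.
  by apply/funext => x.
rewrite E; split; first by apply: emeasurable_funD => //; exact: emeasurable_funD.
rewrite ge0_integralD//; last 3 first.
- by move=> x _; rewrite lee_fin sqr_ge0.
- by move=> x _; rewrite -EFinD lee_fin addr_ge0 ?dyadic_energy_ge0.
- exact: emeasurable_funD.
rewrite ge0_integralD//; last 2 first.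
- by move=> x _; rewrite lee_fin dyadic_energy_ge0.
- by move=> x _; rewrite lee_fin dyadic_energy_ge0.
rewrite (parseval L2Phi ortho) e1 e2 -!EFinD; congr EFin.
rewrite -mulrDr [in RHS]expnS mul2n -addnn addnA.
rewrite -(@big_cat_nat _ _ _ (s + 2 ^ m) s (s + 2 ^ m + 2 ^ m))//= ?leq_addr//.
by rewrite -[m.+2%:R]natr1 mulrDl mul1r addrC expnS mul2n -addnn addnA.
Qed.

(** The coefficients outside [s, t) are set to 0, so that the block can be taken
    inside the dyadic interval [0, 2 ^ m). *)
Lemma rademacher_menshov b s t m (D : set nat) :
  (t <= 2 ^ m)%N -> (forall n, D n -> (n < t)%N) ->
  (\int[mu]_x nnsup D (fun n => (Normc.normc (S b s n.+1 x) ^+ 2)%:E)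
   <= (m.+1%:R ^+ 2 * \sum_(s <= k < t) Normc.normc (b k) ^+ 2)%:E)%E.
Proof.
move=> tm Dt.
pose c k := if (s <= k < t)%N then b k else 0.
have mS s' t' : measurable_fun [set: T]
    (fun x => (Normc.normc (S b s' t' x) ^+ 2)%:E).
  exact/measurable_normc_sqr/L2_cmeasurable/(L2_lincomb L2Phi).
have [mE intE] := integral_dyadic_energy c m 0.
have -> : \sum_(s <= k < t) Normc.normc (b k) ^+ 2 =
    \sum_(0 <= k < 0 + 2 ^ m) Normc.normc (c k) ^+ 2.
  rewrite (@big_nat_widenl _ _ _ s 0)// (big_nat_widen _ _ _ _ _ tm) big_mkcond.
  apply: eq_bigr => k _; rewrite /c /=; case: ifP => //.
  by rewrite Normc.normc0 expr0n.
rewrite expr2 -mulrA EFinM -intE -ge0_integralZl_EFin//; last first.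
  by move=> x _; rewrite lee_fin dyadic_energy_ge0.
apply: ge0_le_integral => //.
- by move=> x _; exact: nnsup_ge0.
- by apply: measurable_nnsup => n.
- exact: measurable_funeM.
move=> x _; rewrite -EFinM.
apply: nnsup_le => [|n /Dt nt].
  by rewrite lee_fin mulr_ge0// dyadic_energy_ge0.
have -> : S b s n.+1 x = \sum_(0 <= k < 0 + n.+1) c k * Phi k x.
  rewrite lincomb_widenl; apply: eq_big_nat => k kn.
  by rewrite /c (leq_trans _ nt) ?andbT.
by rewrite lee_fin; apply: initial_segment_le_dyadic_energy; exact: leq_trans tm.
Qed.

Lemma logarithmic_oscillation N f J (I : J.+1.-tuple nat) : (0 < N)%N ->
  L2 mu f -> incr_seqs J `I_N.+1 I ->
  (Lnorm mu 2%:E (osc2 `I_N.+1 I (fun n => proj_op mu Phi n f))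
   <= (3 / ln 2 * ln N.+1%:R)%:E * L2norm mu f)%E.
Proof.
move=> N0 Lf inI.
(* [2 ^ m] exceeds [N], so every block fits into one dyadic interval; the
   constant 3 absorbs the additive 2 in [m.+1], as [ln 2 <= ln N.+1]. *)
pose m := (trunc_log 2 N).+1.
apply: (@le_trans _ _ ((m.+1%:R : R)%:E * L2norm mu f)%E).
  apply: oscillation_le_maximal => // b s t tN.
  apply: rademacher_menshov => [|n []//].
  by apply: ltnW; apply: leq_ltn_trans (trunc_log_ltn N (ltnSn 1)); exact: tN.
apply: lee_wpmul2r; first exact: Lnorm_ge0.
have ln2 : 0 < ln 2 :> R by rewrite ln_gt0// ltr1n.
rewrite lee_fin mulrAC ler_pdivlMr//.
have le2 : ln 2 <= ln N.+1%:R :> R by rewrite ler_ln ?posrE ?ler_nat.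
have leT : (trunc_log 2 N)%:R * ln 2 <= ln N.+1%:R :> R.
  rewrite mulr_natl -lnXn// ler_ln ?posrE ?exprn_gt0//.
  by rewrite -natrX ler_nat ltnW// ltnS trunc_logP.
rewrite -[m.+1%:R]natr1 -[m%:R]natr1 !mulrDl !mul1r.
set u := _ * ln 2 in leT *; set v := ln N.+1%:R in le2 leT *; lra.
Qed.

Lemma proj_op_lincomb b s t n x : (n < t)%N ->
  proj_op mu Phi n (S b s t) x = S b s n.+1 x.
Proof.
move=> nt; rewrite lincomb_widenl /proj_op big_mkord.
apply: eq_bigr => k _; rewrite (inner_lincomb_Phi L2Phi ortho).
by rewrite (leq_trans (ltn_ord k) nt) andbT.
Qed.

(** The supremum in the assumed estimate is not squared, hence the passage
    through the second power of its L2 norm. *)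
Lemma uniform_oscillation (A : R) : 0 <= A ->
  (forall f, L2 mu f ->
     (Lnorm mu 2%:E (fun x =>
        nnsup [set: nat] (fun n => (Normc.normc (proj_op mu Phi n f x))%:E))
      <= A%:E * L2norm mu f)%E) ->
  forall f J (I : J.+1.-tuple nat), L2 mu f -> incr_seqs J [set: nat] I ->
  (Lnorm mu 2%:E (osc2 [set: nat] I (fun n => proj_op mu Phi n f))
   <= A%:E * L2norm mu f)%E.
Proof.
move=> A0 maxA; apply: oscillation_le_maximal => // b s t _.
have Lg : L2 mu (S b s t) by exact: L2_lincomb.
have mproj n : cmeasurable (proj_op mu Phi n (S b s t)).
  rewrite (_ : proj_op _ _ _ _ = S (fun k => inner mu (S b s t) (Phi k)) 0 n.+1).
    exact/L2_cmeasurable/(L2_lincomb L2Phi).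
  by apply/funext => x; rewrite /lincomb big_mkord.
set U := fun x => nnsup [set: nat] (fun n =>
  (Normc.normc (proj_op mu Phi n (S b s t) x))%:E).
have mU : measurable_fun [set: T] U.
  by apply: measurable_nnsup => n; exact: measurable_normc.
apply: (@le_trans _ _ (\int[mu]_x (`|U x| `^ 2))%E).
  apply: ge0_le_integral => //.
  - by move=> x _; exact: nnsup_ge0.
  - apply: measurable_nnsup => n.
    exact/measurable_normc_sqr/L2_cmeasurable/(L2_lincomb L2Phi).
  - by apply: (measurableT_comp (measurable_poweR 2)); exact: measurableT_comp.
  move=> x _; apply: nnsup_le => [|n [_ nt]]; first exact: poweR_ge0.
  rewrite -(proj_op_lincomb _ _ _ nt) -poweR2_EFin; apply: gt0_ler_poweR => //.
  - by rewrite in_itv /= leey andbT.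
  - by rewrite in_itv /= leey andbT.
  rewrite !gee0_abs ?nnsup_ge0 ?lee_fin ?normc_ge0//.
  exact: (nnsup_ub (fun n => (Normc.normc (proj_op mu Phi n (S b s t) x))%:E)).
rewrite -poweR_Lnorm//.
apply: (@le_trans _ _ ((A%:E * L2norm mu (S b s t)) `^ 2)%E).
  apply: gt0_ler_poweR => //.
  - by rewrite in_itv /= leey andbT; exact: Lnorm_ge0.
  - by rewrite in_itv /= leey andbT; apply: mule_ge0 => //; exact: Lnorm_ge0.
  exact: maxA.
rewrite poweRM// ?Lnorm_ge0// poweR_EFin powR_mulrn// L2normE.
rewrite -poweRrM mulVf// poweRe1; last first.
  by apply: integral_ge0 => x _; rewrite lee_fin sqr_ge0.
by rewrite (parseval L2Phi ortho) EFinM.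
Qed.

End Oscillation.

Theorem proposition3p22 (R : realType) (d : measure_display)
    (T : measurableType d) (mu : {sigma_finite_measure set T -> \bar R})
    (Phi : nat -> T -> R[i]) (Phi_basis : orthonormal_basis mu Phi) :
  (exists C : R, 0 < C /\
     forall (N : nat) (f : T -> R[i]), (0 < N)%N -> L2 mu f ->
       (nnsup [set J | (0 < J)%N] (fun J =>
          nnsup (incr_seqs J `I_N.+1) (fun I =>
            Lnorm mu 2%:E (osc2 `I_N.+1 I (fun n => proj_op mu Phi n f))))
        <= (C * ln N.+1%:R)%:E * L2norm mu f)%E) /\
  ((exists A : R, 0 < A /\
      forall f : T -> R[i], L2 mu f ->
        (Lnorm mu 2%:E (fun x =>
           nnsup [set: nat] (fun n => (Normc.normc (proj_op mu Phi n f x))%:E))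
         <= A%:E * L2norm mu f)%E) ->
   exists C : R, 0 < C /\
     forall f : T -> R[i], L2 mu f ->
       (nnsup [set J | (0 < J)%N] (fun J =>
          nnsup (incr_seqs J [set: nat]) (fun I =>
            Lnorm mu 2%:E (osc2 [set: nat] I (fun n => proj_op mu Phi n f))))
        <= C%:E * L2norm mu f)%E).
Proof.
have [L2Phi ortho _] := Phi_basis.
have ln2 : 0 < ln 2 :> R by rewrite ln_gt0// ltr1n.
split=> [|[A [A0 maxA]]].
  exists (3 / ln 2); split=> [|N f N0 Lf]; first exact: divr_gt0.
  have rhs0 : (0 <= (3 / ln 2 * ln N.+1%:R)%:E * L2norm mu f)%E.
    rewrite mule_ge0 ?Lnorm_ge0// lee_fin mulr_ge0 ?ln_ge0 ?ler1n//.
    by rewrite divr_ge0// ltW.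
  apply: nnsup_le => // J _; apply: nnsup_le => // I inI.
  exact: logarithmic_oscillation.
exists A; split=> // f Lf.
have rhs0 : (0 <= A%:E * L2norm mu f)%E by rewrite mule_ge0 ?Lnorm_ge0// lee_fin ltW.
apply: nnsup_le => // J _; apply: nnsup_le => // I inI.
by apply: uniform_oscillation => //; exact: ltW.
Qed.
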